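(* Let $(\mathfrak g,J,g)$ be an almost abelian pseudo-Kähler Lie algebra of dimension eight, with codimension-one abelian ideal $\mathfrak h$, such that $\mathfrak h^\perp$ is non-isotropic. Then, after possibly replacing $g$ by $-g$, there is a basis $\{e_1,\dots,e_8\}$ of $\mathfrak g$ with $\mathfrak h=\mathrm{Span}\{e_1,\dots,e_7\}$ such that $$Je_1=e_2,\ Je_3=e_4,\ Je_5=e_6,\ Je_7=e_8,\qquad g=\gamma+\varepsilon(e^7\otimes e^7+e^8\otimes e^8),\quad\varepsilon=\pm1,$$ and the derivation $D=\mathrm{ad}(e_8)|_{\mathfrak h}$, written as a matrix in the basis $e_1,\dots,e_7$, and the metric $\gamma$ on $\mathrm{Span}\{e_1,\dots,e_6\}$ are as in one of the following, with $a,\lambda,\lambda_1,\lambda_2,\lambda_3\in\mathbb R$ and $\rho_1>0$: (i) $D=\begin{pmatrix}0&\lambda_1&0&0&0&0&0\\-\lambda_1&0&0&0&0&0&0\\0&0&0&\lambda_2&0&0&0\\0&0&-\lambda_2&0&0&0&0\\0&0&0&0&0&\lambda_3&0\\0&0&0&0&-\lambda_3&0&0\\0&0&0&0&0&0&a\end{pmatrix}$, $\gamma=\sum_{i=1}^6e^i\otimes e^i$; (ii) $D=\begin{pmatrix}0&\lambda_1&1&0&0&0&0\\-\lambda_1&0&0&1&0&0&0\\0&0&0&\lambda_1&0&0&0\\0&0&-\lambda_1&0&0&0&0\\0&0&0&0&0&\lambda_2&0\\0&0&0&0&-\lambda_2&0&0\\0&0&0&0&0&0&a\end{pmatrix}$,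 $\gamma=e^1\odot e^4-e^2\odot e^3+e^5\otimes e^5+e^6\otimes e^6$; (iii) $D$ as the matrix in (i), $\gamma=\sum_{i=1}^4e^i\otimes e^i-e^5\otimes e^5-e^6\otimes e^6$; (iv) $D=\begin{pmatrix}\rho_1&\lambda_1&0&0&0&0&0\\-\lambda_1&\rho_1&0&0&0&0&0\\0&0&-\rho_1&\lambda_1&0&0&0\\0&0&-\lambda_1&-\rho_1&0&0&0\\0&0&0&0&0&\lambda_2&0\\0&0&0&0&-\lambda_2&0&0\\0&0&0&0&0&0&a\end{pmatrix}$, $\gamma=e^1\odot e^4-e^2\odot e^3+e^5\otimes e^5+e^6\otimes e^6$; (v) $D=\begin{pmatrix}0&\lambda&1&0&0&0&0\\-\lambda&0&0&1&0&0&0\\0&0&0&\lambda&1&0&0\\0&0&-\lambda&0&0&1&0\\0&0&0&0&0&\lambda&0\\0&0&0&0&-\lambda&0&0\\0&0&0&0&0&0&a\end{pmatrix}$, $\gamma=-e^1\odot e^5-e^2\odot e^6+e^3\otimes e^3+e^4\otimes e^4$.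
   Context: Lie algebras are real. A Lie algebra is almost abelian if it has a codimension-one abelian ideal $\mathfrak h$. A pseudo-Kähler structure on $\mathfrak g$ is a pair $(J,g)$ with $J\in\mathrm{End}(\mathfrak g)$, $J^2=-\mathrm{Id}$, $[X,Y]+J[JX,Y]+J[X,JY]-[JX,JY]=0$; $g$ a nondegenerate symmetric bilinear form of arbitrary signature with $g(JX,JY)=g(X,Y)$; and $\omega=g(J\cdot,\cdot)$ satisfying $\omega([X,Y],Z)+\omega([Y,Z],X)+\omega([Z,X],Y)=0$. The line $\mathfrak h^\perp$ is non-isotropic if $g$ is nonzero on it. $\{e^i\}$ is the dual basis and $e^i\odot e^j=e^i\otimes e^j+e^j\otimes e^i$. *)

(* Defs.v *)
From HB Require Import structures.
From mathcomp Require Import all_boot all_order all_algebra.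
From mathcomp Require Import reals.

Set Implicit Arguments.
Unset Strict Implicit.
Unset Printing Implicit Defensive.

Import Order.TTheory GRing.Theory Num.Theory.
Local Open Scope ring_scope.

Section PseudoKahler.
Variables (R : realType) (V : vectType R).

Record is_lie_bracket (br : {bilinear V -> V -> V}) : Prop := IsLieBracket {
  lie_alternating : forall x, br x x = 0;
  lie_jacobi : forall x y z, br x (br y z) + br y (br z x) + br z (br x y) = 0
}.

Record codim1_abelian_ideal (br : V -> V -> V) (h : {vspace V}) : Prop :=
  Codim1AbelianIdeal {
    ideal_codim1 : (\dim h).+1 = \dim {:V};
    ideal_closed : forall x y, y \in h -> br x y \in h;
    ideal_abelian : {in h &, forall x y, br x y = 0}
  }.

Record is_complex_structure (br : V -> V -> V) (J : 'End(V)) : Prop :=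
  IsComplexStructure {
    complex_sqr : forall x, J (J x) = - x;
    complex_integrable : forall x y,
      br x y + J (br (J x) y) + J (br x (J y)) - br (J x) (J y) = 0
  }.

Definition fundamental_form (J : 'End(V)) (g : V -> V -> R) : V -> V -> R :=
  fun x y => g (J x) y.

Definition closed_2form (br : V -> V -> V) (w : V -> V -> R) : Prop :=
  forall x y z, w (br x y) z + w (br y z) x + w (br z x) y = 0.

(* No positivity is required: [g] may have any signature. *)
Record is_pseudo_kahler (br : V -> V -> V) (J : 'End(V)) (g : {symmetric V}) :
    Prop := IsPseudoKahler {
  kahler_complex : is_complex_structure br J;
  kahler_nondegenerate : nondegenerate g;
  kahler_compatible : forall x y, g (J x) (J y) = g x y;
  kahler_closed : closed_2form br (fundamental_form J g)
}.

Definition non_isotropic (g : V -> V -> R) (L : {vspace V}) : Prop :=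
  exists2 x, x \in L & g x x != 0.

(* [bvec e i] is e_i and [dual e i] is e^i, with indices running from 1 to 8;
   [dual e] is the dual basis as soon as [e] is a basis. *)
Definition bvec (e : 8.-tuple V) (i : nat) : V := e`_i.-1.

Definition dual (e : 8.-tuple V) (i : nat) : V -> R := coord e (inord i.-1).

Definition tens (a b : V -> R) : V -> V -> R := fun x y => a x * b y.

Definition odot (a b : V -> R) : V -> V -> R :=
  fun x y => tens a b x y + tens b a x y.

(* Column convention: the j-th column of [D] holds the coordinates of
   [e_8, e_j] in e_1, ..., e_7. *)
Definition ad8_matrix (br : V -> V -> V) (e : 8.-tuple V) (D : 'M[R]_7) : Prop :=
  forall j : 'I_7, br (bvec e 8) (bvec e j.+1) =
    \sum_(i < 7) D i j *: bvec e i.+1.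

(* The metrics below live on Span{e_1, ..., e_6}; they are extended by zero
   to the whole space. *)

Definition gamma_definite e : V -> V -> R := fun x y =>
  \sum_(1 <= i < 7) tens (dual e i) (dual e i) x y.

Definition gamma_odot e : V -> V -> R := fun x y =>
  odot (dual e 1) (dual e 4) x y - odot (dual e 2) (dual e 3) x y
  + tens (dual e 5) (dual e 5) x y + tens (dual e 6) (dual e 6) x y.

Definition gamma_diagonal e : V -> V -> R := fun x y =>
  \sum_(1 <= i < 5) tens (dual e i) (dual e i) x y
  - tens (dual e 5) (dual e 5) x y - tens (dual e 6) (dual e 6) x y.

Definition gamma_nilpotent3 e : V -> V -> R := fun x y =>
  - odot (dual e 1) (dual e 5) x y - odot (dual e 2) (dual e 6) x y
  + tens (dual e 3) (dual e 3) x y + tens (dual e 4) (dual e 4) x y.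

End PseudoKahler.

Definition mx_of_rows (R : realType) (m n : nat) (s : seq (seq R)) : 'M[R]_(m, n) :=
  \matrix_(i < m, j < n) (nth [::] s i)`_j.

Section NormalForms.
Variable R : realType.
Implicit Types l a rho : R.

Definition D_diagonal l1 l2 l3 a : 'M[R]_7 := mx_of_rows 7 7
  [:: [::   0;  l1;   0;   0;   0;   0;   0];
      [:: -l1;   0;   0;   0;   0;   0;   0];
      [::   0;   0;   0;  l2;   0;   0;   0];
      [::   0;   0; -l2;   0;   0;   0;   0];
      [::   0;   0;   0;   0;   0;  l3;   0];
      [::   0;   0;   0;   0; -l3;   0;   0];
      [::   0;   0;   0;   0;   0;   0;   a]].

Definition D_nilpotent2 l1 l2 a : 'M[R]_7 := mx_of_rows 7 7
  [:: [::   0;  l1;   1;   0;   0;   0;   0];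
      [:: -l1;   0;   0;   1;   0;   0;   0];
      [::   0;   0;   0;  l1;   0;   0;   0];
      [::   0;   0; -l1;   0;   0;   0;   0];
      [::   0;   0;   0;   0;   0;  l2;   0];
      [::   0;   0;   0;   0; -l2;   0;   0];
      [::   0;   0;   0;   0;   0;   0;   a]].

Definition D_hyperbolic rho l1 l2 a : 'M[R]_7 := mx_of_rows 7 7
  [:: [:: rho;  l1;    0;    0;   0;   0;   0];
      [:: -l1; rho;    0;    0;   0;   0;   0];
      [::   0;   0; -rho;   l1;   0;   0;   0];
      [::   0;   0;  -l1; -rho;   0;   0;   0];
      [::   0;   0;    0;    0;   0;  l2;   0];
      [::   0;   0;    0;    0; -l2;   0;   0];
      [::   0;   0;    0;    0;   0;   0;   a]].

Definition D_nilpotent3 l a : 'M[R]_7 := mx_of_rows 7 7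
  [:: [::  0;  l;  1;  0;  0;  0;  0];
      [:: -l;  0;  0;  1;  0;  0;  0];
      [::  0;  0;  0;  l;  1;  0;  0];
      [::  0;  0; -l;  0;  0;  1;  0];
      [::  0;  0;  0;  0;  0;  l;  0];
      [::  0;  0;  0;  0; -l;  0;  0];
      [::  0;  0;  0;  0;  0;  0;  a]].

End NormalForms.

(* Main.v *)
Require Import Defs.
From HB Require Import structures.
From mathcomp Require Import all_boot all_order all_algebra.
From mathcomp Require Import reals.
From mathcomp Require Import complex ring lra.

Set Implicit Arguments.
Unset Strict Implicit.
Unset Printing Implicit Defensive.

Import Order.TTheory GRing.Theory Num.Theory.
Local Open Scope ring_scope.

(** The theorem reduces to the classification of a self-adjoint operator on a
    complex Hermitian space of signature (3,0) or (2,1).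

    Let n be a unit vector of the line orthogonal to h. Then h is the
    orthogonal of n, the vector J n lies in h, and W = {n, J n}^perp is a
    J-stable nondegenerate subspace of h, of real dimension 6. Since h is
    abelian, integrability says that D = ad n commutes with J on W and
    preserves W, and closedness of the fundamental form says that D is
    skew-symmetric for g on W and that D (J n) is a multiple of J n. Hence
    A = J D is a self-adjoint operator of W commuting with J, and D = - J A.
    Everything is complex linear when J is the multiplication by i, the
    Hermitian form having real part g; all arguments below are nevertheless
    carried out in the real space, a complex number a + i b acting as
    a *: x + b *: J x ([exists_hermitian_operator]).

    The operator A has a complex eigenvector v
    ([exists_complex_eigenvector]). If v is not null, its eigenvalue is real
    and A acts on the orthogonal complement. If v is null, it belongs to a
    hyperbolic pair (v, w), whose complement in W is a complex line spanned by
    some non-null z, and A z = m z + u with u in the complex line of v. Either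
    the eigenvalue of v differs from m, or u = 0, and then a non-null
    eigenvector exists; or A - m is nilpotent of order three and W is a
    single Jordan block ([dim6_classification]). After splitting off a non-null
    eigenvector, the same dichotomy on a space of real dimension 4 gives a
    diagonal operator, a Jordan block of size 2 or a pair of conjugate
    eigenvalues ([dim4_classification]).

    What remains is a matter of scalings and signs: the sign of the metric is
    decided by the complex basis vector that is not null (or by the majority of
    the signs in the diagonal case), and the sign of a Jordan block of size 2 is
    absorbed by replacing e_8 by - e_8 ([dim6_normal_form]). In each case the Gram matrix of
    the basis is a signed permutation matrix, which makes freeness and the
    expression of g in the dual basis immediate
    ([signed_permutation_gram]). *)

(** * Identities between linear combinations *)

(** Reified linear combinations, for proving equalities of vectors by
    comparing coefficients. *)
Section LinearExpressions.
Variables (R : pzRingType) (V : lmodType R).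

Inductive linear_expr :=
  | LinVar of nat
  | LinZero
  | LinAdd of linear_expr & linear_expr
  | LinOpp of linear_expr
  | LinScale of R & linear_expr.

Fixpoint lin_eval (env : seq V) e : V :=
  match e with
  | LinVar i => env`_i
  | LinZero => 0
  | LinAdd e1 e2 => lin_eval env e1 + lin_eval env e2
  | LinOpp e1 => - lin_eval env e1
  | LinScale c e1 => c *: lin_eval env e1
  end.

Fixpoint lin_coef e (i : nat) : R :=
  match e with
  | LinVar j => if j == i then 1 else 0
  | LinZero => 0
  | LinAdd e1 e2 => lin_coef e1 i + lin_coef e2 i
  | LinOpp e1 => - lin_coef e1 i
  | LinScale c e1 => c * lin_coef e1 i
  end.

Fixpoint same_coefs e1 e2 n : Prop :=
  if n is n'.+1 then lin_coef e1 n' = lin_coef e2 n' /\ same_coefs e1 e2 n'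
  else True.

Lemma lin_evalE env e :
  lin_eval env e = \sum_(i < size env) lin_coef e i *: env`_i.
Proof.
elim: e => [j||e1 IH1 e2 IH2|e1 IH|c e1 IH] /=; rewrite ?IH1 ?IH2 ?IH.
- have [j_lt|j_ge] := ltnP j (size env).
    rewrite (bigD1 (Ordinal j_lt)) //= eqxx scale1r big1 ?addr0 // => i.
    by rewrite -val_eqE eq_sym /= => /negPf->; rewrite scale0r.
  rewrite nth_default // big1 // => i _.
  by rewrite gtn_eqF ?scale0r // (leq_trans (ltn_ord i)).
- by rewrite big1 // => i _; rewrite scale0r.
- by rewrite -big_split; apply: eq_bigr => i _; rewrite scalerDl.
- by rewrite -sumrN; apply: eq_bigr => i _; rewrite scaleNr.
- by rewrite scaler_sumr; apply: eq_bigr => i _; rewrite scalerA.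
Qed.

Lemma lin_eval_eq env e1 e2 :
  same_coefs e1 e2 (size env) -> lin_eval env e1 = lin_eval env e2.
Proof.
move=> eqc; rewrite !lin_evalE; apply: eq_bigr => -[i i_lt] _ /=; congr (_ *: _).
elim: (size env) eqc i_lt => //= n IHn [eqn {}/IHn IHn].
by rewrite ltnS leq_eqVlt => /predU1P[->|/IHn].
Qed.

End LinearExpressions.

(* Atoms are compared up to unification, because the same application of a
   linear map may occur with different but convertible structures. *)
Ltac lin_index x env :=
  match env with
  | cons ?y _ => let _ := match goal with _ => unify x y end in constr:(0%N)
  | cons _ ?env' => let i := lin_index x env' in constr:(S i)
  end.

Ltac lin_atoms e env :=
  lazymatch e with
  | @GRing.add _ ?a ?b => let env1 := lin_atoms a env in lin_atoms b env1
  | @GRing.opp _ ?a => lin_atoms a env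
  | @GRing.scale _ _ _ ?a => lin_atoms a env
  | @GRing.zero _ => env
  | _ => match env with
         | _ => let _ := lin_index e env in env
         | _ => constr:(cons e env)
         end
  end.

Ltac lin_reify R e env :=
  lazymatch e with
  | @GRing.add _ ?a ?b =>
      let ea := lin_reify R a env in let eb := lin_reify R b env in
      constr:(LinAdd ea eb)
  | @GRing.opp _ ?a => let ea := lin_reify R a env in constr:(LinOpp ea)
  | @GRing.scale _ _ ?c ?a =>
      let ea := lin_reify R a env in constr:(@LinScale R c ea)
  | @GRing.zero _ => constr:(@LinZero R)
  | _ => let i := lin_index e env in constr:(@LinVar R i)
  end.

(** Reduces an equality in the left R-module V to the equality of the
    coefficients of its atoms, and leaves those that [ring] does not solve. *)
Tactic Notation "lin_eq" constr(R) constr(V) :=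
  lazymatch goal with
  | |- ?e1 = ?e2 =>
    let env0 := lin_atoms e1 (@nil V) in let env := lin_atoms e2 env0 in
    let r1 := lin_reify R e1 env in let r2 := lin_reify R e2 env in
    apply: (@lin_eval_eq R V env r1 r2); rewrite /=; do ?split; try ring
  end.

(** * Complex eigenvectors of operators commuting with J *)

(** The rows x and y are the real and imaginary parts of an eigenvector over
    R[i], for the eigenvalue a + i b. *)
Lemma real_mx_complex_eigenvector (R : rcfType) n (M : 'M[R]_n) : (0 < n)%N ->
  exists (a b : R) (x y : 'rV[R]_n),
    [/\ x *m M = a *: x - b *: y, y *m M = b *: x + a *: y &
        (x != 0) || (y != 0)].
Proof.
move=> n_gt0.
have [z /eigenvalueP[v vM v0]] :=
  eigenvalue_closed (map_mx (real_complex R) M) n_gt0.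
case: z vM => a b vM.
exists a, b, (map_mx (@complex.Re R) v), (map_mx (@complex.Im R) v).
have vME j : \sum_k v 0 k * (M k j)%:C%C = (a +i* b)%C * v 0 j.
  move/matrixP/(_ 0 j): vM; rewrite !mxE => <-.
  by apply: eq_bigr => k _; rewrite mxE.
have Re_sum (F : 'I_n -> R[i]) : complex.Re (\sum_k F k) = \sum_k complex.Re (F k).
  exact: (raddf_sum (@complex.Re R : {additive _ -> _})).
have Im_sum (F : 'I_n -> R[i]) : complex.Im (\sum_k F k) = \sum_k complex.Im (F k).
  exact: (raddf_sum (@complex.Im R : {additive _ -> _})).
split.
- apply/rowP => j; rewrite !mxE.
  move: (congr1 (@complex.Re R) (vME j)); rewrite Re_sum /= => vMj.
  transitivity (complex.Re ((a +i* b)%C * v 0 j)); last by case: (v 0 j).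
  rewrite -vMj; apply: eq_bigr => k _; rewrite !mxE.
  by case: (v 0 k) => p q /=; rewrite mulr0 subr0.
- apply/rowP => j; rewrite !mxE.
  move: (congr1 (@complex.Im R) (vME j)); rewrite Im_sum /= => vMj.
  transitivity (complex.Im ((a +i* b)%C * v 0 j)).
    rewrite -vMj; apply: eq_bigr => k _; rewrite !mxE.
    by case: (v 0 k) => p q /=; rewrite mulr0 add0r.
  by case: (v 0 j) => p q /=; rewrite addrC.
- rewrite -negb_and; apply: contra v0 => /andP[/eqP x0 /eqP y0].
  apply/eqP/rowP => j; rewrite mxE.
  move/rowP/(_ j): x0; move/rowP/(_ j): y0; rewrite !mxE.
  by case: (v 0 j) => p q /= -> ->.
Qed.

(** If x + i y is an eigenvector of the complexification of A, for the
    eigenvalue a + i b, then x + J y and x - J y satisfy the equation for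
    a + i b and a - i b respectively, and they do not both vanish. *)
Lemma exists_complex_eigenvector (R : rcfType) (V : vectType R)
    (J A : {linear V -> V}) (W : {vspace V}) :
  (forall x, J (J x) = - x) -> (forall x, A (J x) = J (A x)) ->
  (forall x, x \in W -> J x \in W) -> (forall x, x \in W -> A x \in W) ->
  (0 < \dim W)%N ->
  exists f a b, [/\ f \in W, f != 0 & A f = a *: f + b *: J f].
Proof.
move=> JJ AJ JW AW W_gt0.
pose M := \matrix_(i < \dim W, j < \dim W) coord (vbasis W) j (A (vbasis W)`_i).
have [a [b [x [y [xM yM xy0]]]]] := real_mx_complex_eigenvector M W_gt0.
pose vec (u : 'rV_(\dim W)) := \sum_i u 0 i *: (vbasis W)`_i.
have vecD u v : vec (u + v) = vec u + vec v.
  by rewrite -big_split; apply: eq_bigr => i _; rewrite mxE scalerDl.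
have vecZ c u : vec (c *: u) = c *: vec u.
  by rewrite scaler_sumr; apply: eq_bigr => i _; rewrite mxE scalerA.
have vecW u : vec u \in W.
  by apply: rpred_sum => i _; apply/rpredZ/vbasis_mem/mem_nth; rewrite size_tuple.
have vec_eq0 u : vec u = 0 -> u = 0.
  have/freeP := basis_free (vbasisP W).
  by move=> bfree u0; apply/rowP => i; rewrite mxE (bfree (u 0)).
have vecA u : A (vec u) = vec (u *m M).
  rewrite linear_sum /=.
  transitivity (\sum_i \sum_j (u 0 i * M i j) *: (vbasis W)`_j).
    apply: eq_bigr => i _; rewrite linearZ /=.
    rewrite {1}(coord_vbasis (AW _ (vbasis_mem (mem_nth 0 _)))) ?size_tuple //.
    by rewrite scaler_sumr; apply: eq_bigr => j _; rewrite mxE scalerA.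
  rewrite exchange_big; apply: eq_bigr => j _.
  by rewrite -scaler_suml mxE.
pose X := vec x; pose Y := vec y.
have AX : A X = a *: X - b *: Y by rewrite vecA xM vecD -scaleNr !vecZ scaleNr.
have AY : A Y = b *: X + a *: Y by rewrite vecA yM vecD !vecZ.
have [f0|] := eqVneq (X + J Y) 0; last first.
  move=> f0; exists (X + J Y), a, b; split=> //; first by rewrite rpredD ?JW ?vecW.
  rewrite linearD AJ AX AY !linearD !linearZ /= JJ.
  by lin_eq R V.
exists (X - J Y), a, (- b).
split; first by rewrite rpredB ?JW ?vecW.
  apply: contraTneq xy0 => f1; rewrite -negb_and negbK.
  have X0 : X = 0.
    have : X *+ 2 = 0 by rewrite mulr2n -[X in X + _](addrK (J Y)) f0 add0r addrC f1.
    by move/eqP; rewrite -scaler_nat scaler_eq0 pnatr_eq0 /= => /eqP.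
  have Y0 : Y = 0.
    move: f0; rewrite X0 add0r => /(congr1 J); rewrite JJ linear0.
    by move/eqP; rewrite oppr_eq0 => /eqP.
  by rewrite (vec_eq0 _ X0) (vec_eq0 _ Y0) eqxx.
rewrite linearB AJ AX AY !linearD !linearN /= !linearZ /= JJ.
by lin_eq R V.
Qed.

(** * Geometry of Hermitian subspaces *)

(** The Hermitian form behind g and J is x, y |-> g x y + i g x (J y), so that
    Hermitian orthogonality is the vanishing of both g x y and g x (J y). *)
Section HermitianGeometry.
Variables (R : rcfType) (V : vectType R) (g : {symmetric V}).
Variable J : {linear V -> V}.
Hypothesis JJ : forall x, J (J x) = - x.
Hypothesis gJJ : forall x y, g (J x) (J y) = g x y.

Lemma symC x y : g x y = g y x.
Proof. by rewrite hermC expr0 mul1r. Qed.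

Lemma symDl x y z : g (x + y) z = g x z + g y z.
Proof. exact: linearDl. Qed.
Lemma symDr x y z : g z (x + y) = g z x + g z y.
Proof. exact: linearDr. Qed.
Lemma symNl x z : g (- x) z = - g x z.
Proof. exact: linearNl. Qed.
Lemma symNr x z : g z (- x) = - g z x.
Proof. exact: linearNr. Qed.
Lemma symZl a x z : g (a *: x) z = a * g x z.
Proof. exact: linearZl_LR. Qed.
Lemma symZr a x z : g z (a *: x) = a * g z x.
Proof. exact: linearZr_LR. Qed.
Lemma sym0l z : g 0 z = 0.
Proof. exact: linear0l. Qed.
Lemma sym0r z : g z 0 = 0.
Proof. exact: linear0r. Qed.
Lemma JD x y : J (x + y) = J x + J y. Proof. exact: linearD. Qed.
Lemma JN x : J (- x) = - J x. Proof. exact: linearN. Qed.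
Lemma JZ a x : J (a *: x) = a *: J x. Proof. exact: linearZ. Qed.

Lemma symJl x y : g (J x) y = - g x (J y).
Proof. by rewrite -gJJ JJ symNl. Qed.

Lemma symJ_eq0 x : g x (J x) = 0.
Proof. by have := symJl x x; rewrite symC; lra. Qed.

Definition symE := (symDl, symDr, symNl, symNr, symZl, symZr, sym0l, sym0r,
  symJl, JD, JN, JZ, JJ, symJ_eq0).

Record hermitian_subspace (W : {vspace V}) : Prop := HermitianSubspace {
  herm_J : forall x, x \in W -> J x \in W;
  herm_nondeg : forall x, x \in W -> {in W, forall y, g x y = 0} -> x = 0
}.

(** Polarization: a form vanishing on the diagonal vanishes. *)
Lemma exists_non_null (W : {vspace V}) :
  hermitian_subspace W -> (0 < \dim W)%N -> exists2 x, x \in W & g x x != 0.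
Proof.
move=> hW; rewrite lt0n dimv_eq0 => W0.
have v0 := vpick0 W; have vW := memv_pick W.
set v := vpick W in v0 vW.
have [|] := boolP (v \in orthov g W).
  move=> /mem_orthovP vperp; move: v0.
  by rewrite (herm_nondeg hW vW vperp) eqxx (negPf W0).
move=> /mem_orthovPn[y yW gvy].
have [vv|] := eqVneq (g v v) 0; last by exists v.
have [yy|] := eqVneq (g y y) 0; last by exists y.
exists (v + y); first exact: rpredD.
by rewrite !symE vv yy (symC y v) addr0 add0r -mulr2n mulrn_eq0.
Qed.

(** The Hermitian orthogonal complement of f in W. *)
Definition cperp (W : {vspace V}) f :=
  (W :&: orthov g <[f]> :&: orthov g <[J f]>)%VS.

Lemma mem_cperp (W : {vspace V}) f x :
  (x \in cperp W f) = [&& x \in W, g x f == 0 & g x (J f) == 0].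
Proof. by rewrite !memv_cap !mem_orthov1 andbA. Qed.

Lemma cperpP (W : {vspace V}) f x :
  reflect [/\ x \in W, g x f = 0 & g x (J f) = 0] (x \in cperp W f).
Proof.
by rewrite mem_cperp; apply: (iffP and3P) => [[? /eqP ? /eqP ?]|[? -> ->]].
Qed.

Lemma cperp_decomp (W : {vspace V}) f x :
  hermitian_subspace W -> f \in W -> g f f != 0 -> x \in W ->
  x - (g x f / g f f) *: f - (g x (J f) / g f f) *: J f \in cperp W f.
Proof.
move=> hW fW ff xW; apply/cperpP; split.
- by rewrite !rpredB ?rpredZ ?(herm_J hW).
- by rewrite !symE; field.
- by rewrite !symE; field.
Qed.

Lemma cperp_hermitian (W : {vspace V}) f : hermitian_subspace W -> f \in W ->
  g f f != 0 -> hermitian_subspace (cperp W f).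
Proof.
move=> hW fW ff; split=> x /cperpP[xW xf xJf].
  by apply/cperpP; split; rewrite ?(herm_J hW) // !symE ?xJf ?xf ?oppr0.
move=> xperp; apply: (herm_nondeg hW) => // y yW.
have := xperp _ (cperp_decomp hW fW ff yW).
by rewrite !symE xf xJf => <-; ring.
Qed.

Lemma dim_cperp (W : {vspace V}) f : hermitian_subspace W -> f \in W -> g f f != 0 ->
  \dim W = (\dim (cperp W f)).+2.
Proof.
move=> hW fW ff.
have W1 : f \notin orthov g W by apply/mem_orthovPn; exists f.
have W2 : J f \notin orthov g (W :&: orthov g <[f]>).
  apply/mem_orthovPn; exists (J f); last by rewrite gJJ.
  by rewrite memv_cap (herm_J hW) //= mem_orthov1 !symE oppr0.
have pos (U : {vspace V}) y : y \notin orthov g U -> (0 < \dim U)%N.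
  case: (posnP (\dim U)) => // /eqP; rewrite dimv_eq0 => /eqP->.
  by move=> /mem_orthovPn[z]; rewrite memv0 => /eqP->; rewrite sym0r eqxx.
by rewrite -(prednK (pos _ _ W1)) (eq_dim_orthov1 W1) -(prednK (pos _ _ W2))
   (eq_dim_orthov1 W2).
Qed.

(** The complement of f in W has dimension zero. *)
Lemma complex_line_span (W : {vspace V}) f x : hermitian_subspace W -> \dim W = 2%N ->
  f \in W -> g f f != 0 -> x \in W ->
  x = (g x f / g f f) *: f + (g x (J f) / g f f) *: J f.
Proof.
move=> hW dimW fW ff xW; have := cperp_decomp hW fW ff xW.
have /eqP: \dim (cperp W f) = 0%N by move: (dim_cperp hW fW ff); rewrite dimW => -[].
rewrite dimv_eq0 => /eqP->; rewrite memv0 -addrA -opprD subr_eq0.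
by move/eqP.
Qed.

Record hyperbolic_pair v w : Prop := HyperbolicPair {
  hyp_vv : g v v = 0; hyp_ww : g w w = 0;
  hyp_vw : g v w = 1; hyp_vJw : g v (J w) = 0
}.

Lemma hyp_wv v w : hyperbolic_pair v w -> g w v = 1.
Proof. by case=> _ _ vw _; rewrite symC. Qed.
Lemma hyp_wJv v w : hyperbolic_pair v w -> g w (J v) = 0.
Proof. by case=> _ _ _ vJw; rewrite symC symJl vJw oppr0. Qed.

(** Nondegeneracy gives y with g v y <> 0; multiplying y by a complex number
    makes its Hermitian product with v equal to 1, and subtracting a real
    multiple of v then makes it null. *)
Lemma exists_hyperbolic_partner (W : {vspace V}) v : hermitian_subspace W -> v \in W ->
  v != 0 -> g v v = 0 -> exists2 w, w \in W & hyperbolic_pair v w.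
Proof.
move=> hW vW v0 vv.
have /mem_orthovPn[y yW vy] : v \notin orthov g W.
  apply: contra v0 => /mem_orthovP vperp; apply/eqP.
  exact: (herm_nondeg hW).
(* The multiplier is (p + i q) / c, the inverse of p - i q. *)
pose p := g v y; pose q := g v (J y); pose c := p ^+ 2 + q ^+ 2.
have c0 : c != 0.
  by rewrite gt_eqF // ltr_wpDr ?sqr_ge0 // lt0r sqr_ge0 sqrf_eq0 vy.
have [w0 [w0W vw0 vJw0]] : exists w0, [/\ w0 \in W, g v w0 = 1 & g v (J w0) = 0].
  exists ((p / c) *: y + (q / c) *: J y).
  split; first by rewrite rpredD ?rpredZ ?(herm_J hW).
    by rewrite !symE -/p -/q; apply: (mulfI c0); rewrite /c; field.
  by rewrite !symE -/p -/q; field.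
exists (w0 - (g w0 w0 / 2) *: v); first by rewrite rpredB ?rpredZ.
split=> //.
- by rewrite !symE (symC w0 v) vv vw0; field.
- by rewrite symDr symNr symZr vv vw0; ring.
- by rewrite JD JN JZ symDr symNr symZr symJ_eq0 vJw0; ring.
Qed.

(** The vectors w + v and w - v are orthogonal and not null, so the complement
    of the pair is obtained by taking the complement of one vector twice. *)
Lemma hyperbolic_perp (W : {vspace V}) v w :
  hermitian_subspace W -> v \in W -> w \in W -> hyperbolic_pair v w ->
  exists U : {vspace V}, [/\ hermitian_subspace U, \dim W = (\dim U).+4 &
    forall x, x \in U <-> [/\ x \in W, g x v = 0, g x (J v) = 0, g x w = 0
                         & g x (J w) = 0]].
Proof.
move=> hW vW wW hvw; have [vv ww vw vJw] := hvw.
have wv := hyp_wv hvw; have wJv := hyp_wJv hvw.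
have pW : w + v \in W by rewrite rpredD.
have pp : g (w + v) (w + v) != 0.
  by rewrite !symE vv ww vw wv; apply/eqP; lra.
have mW : w - v \in cperp W (w + v).
  apply/cperpP; split; rewrite ?rpredB // !symE ?vv ?ww ?vw ?wv ?vJw ?wJv; ring.
have mm : g (w - v) (w - v) != 0.
  by rewrite !symE vv ww vw wv; apply/eqP; lra.
have hW1 := cperp_hermitian hW pW pp.
exists (cperp (cperp W (w + v)) (w - v)); split.
- by apply: (cperp_hermitian hW1 mW mm).
- by rewrite (dim_cperp hW pW pp) (dim_cperp hW1 mW mm).
- move=> x; split=> [/cperpP[/cperpP[xW]]|[xW xv xJv xw xJw]].
    by rewrite !symE => *; split=> //; lra.
  apply/cperpP; split; first apply/cperpP; first split=> //.
  all: by rewrite !symE ?xv ?xJv ?xw ?xJw; ring.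
Qed.

Lemma hyperbolic_decomp v w (x : V)
    (y := x - g x w *: v - g x (J w) *: J v - g x v *: w - g x (J v) *: J w) :
  hyperbolic_pair v w ->
  [/\ g y v = 0, g y (J v) = 0, g y w = 0 & g y (J w) = 0].
Proof.
move=> hvw; have [vv ww vw vJw] := hvw.
have wv := hyp_wv hvw; have wJv := hyp_wJv hvw.
by rewrite /y; split; rewrite !symE ?vv ?ww ?vw ?wv ?vJw ?wJv; ring.
Qed.

End HermitianGeometry.

(** * Self-adjoint operators in complex dimension two and three *)
Section SelfAdjoint.
Variables (R : rcfType) (V : vectType R) (g : {symmetric V}).
Variables J A : {linear V -> V}.
Hypothesis JJ : forall x, J (J x) = - x.
Hypothesis gJJ : forall x y, g (J x) (J y) = g x y.
Hypothesis AJ : forall x, A (J x) = J (A x).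
Hypothesis gA : forall x y, g (A x) y = g x (A y).

Let symE := symE JJ gJJ.
Let symC := symC g.
Let hermitian_subspace := hermitian_subspace g J.
Let hyperbolic_pair := hyperbolic_pair g J.
Let cperp := cperp g J.

(** The Hermitian product of A x and x is real. *)
Lemma selfadjoint_J_eq0 x : g (A x) (J x) = 0.
Proof. by have := symC (A x) (J x); rewrite (symJl JJ gJJ) -AJ -gA; lra. Qed.

Definition shift a x := A x - a *: x.

Lemma AD x y : A (x + y) = A x + A y. Proof. exact: linearD. Qed.
Lemma AN x : A (- x) = - A x. Proof. exact: linearN. Qed.
Lemma AZ a x : A (a *: x) = a *: A x. Proof. exact: linearZ. Qed.

(* Pushes A through linear combinations, leaving J outermost. *)
Definition AE := (AD, AN, AZ, AJ).

Lemma eigenvalue_real f a b :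
  g f f != 0 -> A f = a *: f + b *: J f -> A f = a *: f.
Proof.
move=> ff Af; have := selfadjoint_J_eq0 f.
rewrite Af symDl !symZl gJJ symJ_eq0 // mulr0 add0r => /eqP.
by rewrite mulf_eq0 (negPf ff) orbF => /eqP->; rewrite scale0r addr0.
Qed.

Lemma cperp_stable (W : {vspace V}) f a : (forall x, x \in W -> A x \in W) ->
  A f = a *: f -> forall x, x \in cperp W f -> A x \in cperp W f.
Proof.
move=> AW Af x /cperpP[xW xf xJf]; apply/cperpP.
by split; rewrite ?AW // gA ?AJ Af !symE ?xf ?xJf mulr0.
Qed.

Lemma complex_line_eigenvector (W : {vspace V}) z : hermitian_subspace W ->
  (forall x, x \in W -> A x \in W) -> \dim W = 2%N -> z \in W -> g z z != 0 ->
  exists m, A z = m *: z.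
Proof.
move=> hW AW dimW zW zz; exists (g (A z) z / g z z).
apply: (eigenvalue_real zz (b := g (A z) (J z) / g z z)).
exact: (complex_line_span JJ gJJ hW dimW zW zz (AW _ zW)).
Qed.

(** The three possibilities: orthogonal non-null eigenvectors, a Jordan block
    of size 2 for a real eigenvalue, or a pair of conjugate eigenvalues. *)
Inductive dim4_form (W : {vspace V}) : Prop :=
| Dim4Diagonal x y a b of x \in W & y \in W & g x x != 0 & g y y != 0 &
    g x y = 0 & g x (J y) = 0 & A x = a *: x & A y = b *: y
| Dim4Jordan v w a c of v \in W & w \in W & hyperbolic_pair v w & c != 0 &
    A v = a *: v & A w = a *: w + c *: v
| Dim4Complex v w a b of v \in W & w \in W & hyperbolic_pair v w & 0 < b &
    A v = a *: v + b *: J v & A w = a *: w - b *: J w.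

Lemma hyperbolic_pair_sym v w : hyperbolic_pair v w -> hyperbolic_pair w v.
Proof.
move=> vw; have := hyp_wJv JJ gJJ vw; have := hyp_wv vw.
by case: vw => *; split.
Qed.

(** Three of the four coordinates of A w along the hyperbolic pair are forced
    by self-adjointness; only the real coordinate g (A w) w along v is free. *)
Lemma isotropic_eigenvector_partner v w a b : hyperbolic_pair v w ->
  A v = a *: v + b *: J v ->
  [/\ g (A w) v = a, g (A w) (J v) = - b & g (A w) (J w) = 0].
Proof.
move=> hvw Av; rewrite selfadjoint_J_eq0 !gA AJ Av.
rewrite !symE (hyp_wv hvw) (hyp_wJv JJ gJJ hvw).
by split=> //; ring.
Qed.

(** If the eigenvector f is null, with partner w, the previous lemma gives
    A w = a w - b J w + c f with c real. For b <> 0 the term c f is removed by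
    adding to w the multiple c / 2b of J f, which keeps the pair hyperbolic. For
    b = 0 it is a Jordan block, unless c = 0, when w + f and w - f are
    orthogonal non-null eigenvectors. *)
Lemma dim4_classification (W : {vspace V}) : hermitian_subspace W ->
  (forall x, x \in W -> A x \in W) -> \dim W = 4%N -> dim4_form W.
Proof.
move=> hW AW dimW.
have [|f [a [b [fW f0 Af]]]] := exists_complex_eigenvector JJ AJ (herm_J hW) AW.
  by rewrite dimW.
have [ff|ff] := eqVneq (g f f) 0; last first.
  have hU := cperp_hermitian JJ gJJ hW fW ff.
  have dimU := dim_cperp JJ gJJ hW fW ff; rewrite dimW in dimU.
  case: dimU => dimU.
  have [|y yU yy] := exists_non_null hU; first by rewrite -dimU.
  have {}Af := eigenvalue_real ff Af.
  have [m Ay] := complex_line_eigenvector hU (cperp_stable AW Af) (esym dimU) yU yy.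
  have [yW yf yJf] := cperpP _ _ _ _ _ yU.
  apply: (Dim4Diagonal fW yW ff yy _ _ Af Ay); first by rewrite symC.
  by rewrite -(opprK (g f _)) -(symJl JJ gJJ) symC yJf oppr0.
have [w wW hvw] := exists_hyperbolic_partner JJ gJJ hW fW f0 ff.
have [U [hU dimU memU]] := hyperbolic_perp JJ gJJ hW fW wW hvw.
have U0 : U = 0%VS by apply/eqP; rewrite -dimv_eq0; move: dimU; rewrite dimW => -[<-].
have [Awv AwJv AwJw] := isotropic_eigenvector_partner hvw Af.
have Aw : A w = a *: w - b *: J w + g (A w) w *: f.
  set y := A w - g (A w) w *: f - g (A w) (J w) *: J f - g (A w) f *: w
           - g (A w) (J f) *: J w.
  have [y1 y2 y3 y4] := hyperbolic_decomp JJ gJJ (A w) hvw; rewrite -/y in y1 y2 y3 y4.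
  have : y \in U.
    by apply/memU; split=> //; rewrite !rpredB ?rpredZ ?(herm_J hW) ?AW.
  rewrite U0 memv0 /y AwJw Awv AwJv scale0r subr0 => /eqP y0.
  by apply/eqP; rewrite -subr_eq0 -y0; apply/eqP; lin_eq R V.
set c := g (A w) w in Aw.
have [b0|b0] := eqVneq b 0.
  rewrite b0 !scale0r subr0 ?addr0 in Af Aw.
  have [c0|c0] := eqVneq c 0; last exact: (Dim4Jordan fW wW hvw c0 Af Aw).
  have [vv ww vw vJw] := hvw.
  have wv := hyp_wv hvw; have wJv := hyp_wJv JJ gJJ hvw.
  rewrite c0 scale0r addr0 in Aw.
  apply: (@Dim4Diagonal W (w + f) (w - f) a a).
  - by rewrite rpredD.
  - by rewrite rpredB.
  - by rewrite !symE vv ww vw wv; apply/eqP; lra.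
  - by rewrite !symE vv ww vw wv; apply/eqP; lra.
  - by rewrite !symE vv ww vw wv; ring.
  - by rewrite !symE vJw wJv; ring.
  - by rewrite !AE Aw Af scalerDr.
  - by rewrite !AE Aw Af scalerBr.
have hvw' : hyperbolic_pair f (w + (c / (b *+ 2)) *: J f).
  have [vv ww vw vJw] := hvw.
  have wv := hyp_wv hvw; have wJv := hyp_wJv JJ gJJ hvw.
  by split=> //; rewrite !symE ?vv ?ww ?vw ?vJw ?wv ?wJv; ring.
have w'W : w + (c / (b *+ 2)) *: J f \in W by rewrite rpredD ?rpredZ ?(herm_J hW).
have Aw' : A (w + (c / (b *+ 2)) *: J f) = a *: (w + (c / (b *+ 2)) *: J f)
    - b *: J (w + (c / (b *+ 2)) *: J f).
  by rewrite !AE Aw Af !symE; lin_eq R V; field.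
have [b_gt0|b_le0] := ltP 0 b.
  exact: (Dim4Complex fW w'W hvw' b_gt0 Af Aw').
apply: (@Dim4Complex W _ _ a (- b) w'W fW (hyperbolic_pair_sym hvw')).
- by rewrite oppr_gt0 lt_neqAle b0.
- by rewrite Aw' scaleNr.
- by rewrite Af scaleNr opprK.
Qed.

(** Either an eigenline splits off, or A is a single Jordan block, with w as
    cyclic vector. *)
Inductive dim6_form (W : {vspace V}) : Prop :=
| Dim6Split f a of f \in W & g f f != 0 & A f = a *: f
| Dim6Jordan w a of w \in W & shift a (shift a (shift a w)) = 0 &
    g (shift a (shift a w)) w != 0.

(** Let v be a null eigenvector for a + i b, w its partner and z a non-null
    vector orthogonal to both. Then A z = m z + (p + i q) v. If m <> a + i b, a
    complex multiple of v added to z gives an eigenvector for m of the same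
    norm as z. If m = a + i b and p + i q <> 0, self-adjointness of N = A - m gives
    the component of N w along z, whence N (N w) is a nonzero real multiple of v. *)
Lemma dim6_classification (W : {vspace V}) : hermitian_subspace W ->
  (forall x, x \in W -> A x \in W) -> \dim W = 6%N -> dim6_form W.
Proof.
move=> hW AW dimW.
have [|v [a [b [vW v0 Av]]]] := exists_complex_eigenvector JJ AJ (herm_J hW) AW.
  by rewrite dimW.
have [vv|vv] := eqVneq (g v v) 0; last exact: (Dim6Split vW vv (eigenvalue_real vv Av)).
have [w wW hvw] := exists_hyperbolic_partner JJ gJJ hW vW v0 vv.
have [_ ww vw vJw] := hvw; have wv := hyp_wv hvw; have wJv := hyp_wJv JJ gJJ hvw.
have [U [hU dimU memU]] := hyperbolic_perp JJ gJJ hW vW wW hvw.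
rewrite dimW in dimU; case: dimU => /esym dimU.
have [|z zU zz] := exists_non_null hU; first by rewrite dimU.
have [zW zv zJv zw zJw] := (memU z).1 zU.
have proj x : x \in W -> g x v = 0 -> g x (J v) = 0 ->
    x - g x w *: v - g x (J w) *: J v \in U.
  move=> xW xv xJv; apply/memU.
  have := hyperbolic_decomp JJ gJJ x hvw.
  rewrite xv xJv !scale0r !subr0 => -[]; split=> //.
  by rewrite !rpredB ?rpredZ ?(herm_J hW).
have [m Az] : exists m, A z = m *: z + g (A z) w *: v + g (A z) (J w) *: J v.
  have Azv : g (A z) v = 0 by rewrite gA Av !symE zv zJv; ring.
  have AzJv : g (A z) (J v) = 0 by rewrite gA AJ Av !symE zv zJv; ring.
  have := complex_line_span JJ gJJ hU dimU zU zz (proj _ (AW _ zW) Azv AzJv).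
  set y := A z - _ - _.
  have -> : g y (J z) = 0.
    by rewrite /y !symE selfadjoint_J_eq0 (symC v (J z)) (symC v z) !symE zv zJv; ring.
  rewrite mul0r scale0r addr0 /y => eqy; exists (g y z / g z z); rewrite -eqy.
  by lin_eq R V.
set p := g (A z) w in Az; set q := g (A z) (J w) in Az.
pose d := (m - a) ^+ 2 + b ^+ 2.
have [d0|d0] := eqVneq d 0; last first.
  (* k + i l = (p + i q) / (m - a - i b). *)
  pose k := (p * (m - a) - q * b) / d; pose l := (q * (m - a) + p * b) / d.
  apply: (@Dim6Split W (z + k *: v + l *: J v) m).
  - by rewrite !rpredD ?rpredZ ?(herm_J hW).
  - by rewrite !symE vv (symC v z) zv (symC v (J z)) !symE zJv !(mulr0, oppr0, addr0).
  - rewrite !AE Az Av !symE.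
    by lin_eq R V; rewrite /k /l; apply: (mulfI d0); rewrite /d; field.
have [ma0 b0] : m = a /\ b = 0.
  move/eqP: d0; rewrite /d paddr_eq0 ?sqr_ge0 // !sqrf_eq0 subr_eq0.
  by case/andP => /eqP-> /eqP->.
rewrite {m}ma0 in d Az d0; rewrite b0 scale0r addr0 in Av.
have [u0|u0] := eqVneq (p *: v + q *: J v) 0.
  by apply: (Dim6Split zW zz (a := a)); rewrite Az -addrA u0 addr0.
have pq : p ^+ 2 + q ^+ 2 != 0.
  apply: contra u0; rewrite paddr_eq0 ?sqr_ge0 // !sqrf_eq0 => /andP[/eqP-> /eqP->].
  by rewrite !scale0r addr0.
pose N := shift a.
have NE x y : g (N x) y = g x (N y) by rewrite /N /shift !symE gA.
have ND x y : N (x + y) = N x + N y by rewrite /N /shift !AE; lin_eq R V.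
have NZ c x : N (c *: x) = c *: N x by rewrite /N /shift !AE; lin_eq R V.
have NJ x : N (J x) = J (N x) by rewrite /N /shift !AE !symE; lin_eq R V.
have Nv : N v = 0 by rewrite /N /shift Av subrr.
have Nz : N z = p *: v + q *: J v by rewrite /N /shift Az; lin_eq R V.
have NS x : shift a x = N x by [].
have NwW : N w \in W by rewrite rpredB ?rpredZ ?AW.
clearbody N.
have [p' [q' Nw]] : exists p' q',
    N w = p' *: v + q' *: J v + (p / g z z) *: z - (q / g z z) *: J z.
  have Nwv : g (N w) v = 0 by rewrite NE Nv sym0r.
  have NwJv : g (N w) (J v) = 0 by rewrite NE NJ Nv linear0 sym0r.
  have := complex_line_span JJ gJJ hU dimU zU zz (proj _ NwW Nwv NwJv).
  set y := N w - _ - _.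
  have -> : g y z = p.
    by rewrite /y !symE (symC v z) (symC v (J z)) NE Nz !symE zv zJv wv wJv; ring.
  have -> : g y (J z) = - q.
    rewrite /y !symE (symC v z) (symC v (J z)) NE NJ Nz !symE zv zJv wv wJv; ring.
  rewrite /y mulNr scaleNr => eqy.
  exists (g (N w) w), (g (N w) (J w)); rewrite -addrA -eqy; lin_eq R V.
have NNw : N (N w) = ((p ^+ 2 + q ^+ 2) / g z z) *: v.
  rewrite Nw !ND -scaleNr !NZ !NJ Nz Nv !symE !linear0. by lin_eq R V; field.
apply: (@Dim6Jordan W w a wW); rewrite !NS NNw.
  by rewrite NZ Nv scaler0.
by rewrite symZl vw mulr1 mulf_neq0 ?invr_eq0.
Qed.

End SelfAdjoint.

(** * Normalization of lengths and signs *)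
Section NormalForms.
Variables (R : rcfType) (V : vectType R) (g : {symmetric V}).
Variables J A : {linear V -> V}.
Hypothesis JJ : forall x, J (J x) = - x.
Hypothesis gJJ : forall x y, g (J x) (J y) = g x y.
Hypothesis AJ : forall x, A (J x) = J (A x).
Hypothesis gA : forall x y, g (A x) y = g x (A y).

Let symE := symE JJ gJJ.
Let symC := symC g.
Let AE := AE AJ.

Definition is_sign (s : R) := s = 1 \/ s = -1.

Lemma sign_sqr s : is_sign s -> s * s = 1.
Proof. by case=> ->; ring. Qed.

Definition complex_orthogonal x y := g x y = 0 /\ g x (J y) = 0.

Lemma complex_orthogonal_sym x y :
  complex_orthogonal x y -> complex_orthogonal y x.
Proof. by case=> xy xJy; split; rewrite symC ?(symJl JJ gJJ) ?xy ?xJy ?oppr0. Qed.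

Lemma exists_sign_scaling (c : R) : c != 0 ->
  exists r s, [/\ r != 0, is_sign s & r ^+ 2 * c = s].
Proof.
move=> c0; have sq0 : Num.sqrt `|c| != 0 by rewrite sqrtr_eq0 -ltNge normr_gt0.
exists (Num.sqrt `|c|)^-1; have [c_gt0|c_le0] := ltP 0 c.
  exists 1; split; [by rewrite invr_eq0 | by left |].
  by rewrite exprVn sqr_sqrtr ?normr_ge0 // gtr0_norm // mulVf.
exists (-1); split; [by rewrite invr_eq0 | by right |].
by rewrite exprVn sqr_sqrtr ?normr_ge0 // ler0_norm // invrN mulNr mulVf.
Qed.

(** The complex vectors f1, f2, f3 are e_1, e_3, e_5; the sign s multiplies
    the metric, and t is the sign by which n is to be multiplied to give e_8,
    so that ad e_8 = - t J A on W. *)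
Inductive hermitian_normal_form (W : {vspace V}) : Prop :=
| NormalDiagonal s f1 f2 f3 l1 l2 l3 of
    is_sign s & [/\ f1 \in W, f2 \in W & f3 \in W] &
    [/\ complex_orthogonal f1 f2, complex_orthogonal f1 f3
      & complex_orthogonal f2 f3] &
    [/\ s * g f1 f1 = 1, s * g f2 f2 = 1 & is_sign (s * g f3 f3)] &
    [/\ A f1 = l1 *: f1, A f2 = l2 *: f2 & A f3 = l3 *: f3]
| NormalJordan2 s t f1 f2 f3 l1 l2 of
    is_sign s & is_sign t & [/\ f1 \in W, f2 \in W & f3 \in W] &
    [/\ g f1 f1 = 0, g f2 f2 = 0, g f1 f2 = 0 & s * g f1 (J f2) = 1] &
    [/\ complex_orthogonal f1 f3, complex_orthogonal f2 f3 & s * g f3 f3 = 1] &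
    [/\ A f1 = l1 *: f1, A f2 = l1 *: f2 + t *: J f1 & A f3 = l2 *: f3]
| NormalComplex s f1 f2 f3 rho l1 l2 of
    is_sign s & 0 < rho & [/\ f1 \in W, f2 \in W & f3 \in W] &
    [/\ g f1 f1 = 0, g f2 f2 = 0, g f1 f2 = 0 & s * g f1 (J f2) = 1] &
    [/\ complex_orthogonal f1 f3, complex_orthogonal f2 f3 & s * g f3 f3 = 1] &
    [/\ A f1 = l1 *: f1 + rho *: J f1, A f2 = l1 *: f2 - rho *: J f2
      & A f3 = l2 *: f3]
| NormalJordan3 s f1 f2 f3 l of
    is_sign s & [/\ f1 \in W, f2 \in W & f3 \in W] &
    [/\ g f1 f1 = 0, g f3 f3 = 0, s * g f1 f3 = -1 & g f1 (J f3) = 0] &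
    [/\ complex_orthogonal f1 f2, complex_orthogonal f2 f3 & s * g f2 f2 = 1] &
    [/\ A f1 = l *: f1, A f2 = l *: f2 + J f1 & A f3 = l *: f3 + J f2].

Lemma normal_form_diagonal (W : {vspace V}) x y z a b c :
  x \in W -> y \in W -> z \in W ->
  complex_orthogonal x y -> complex_orthogonal x z -> complex_orthogonal y z ->
  g x x != 0 -> g y y != 0 -> g z z != 0 ->
  A x = a *: x -> A y = b *: y -> A z = c *: z ->
  hermitian_normal_form W.
Proof.
move=> xW yW zW xy xz yz xx yy zz Ax Ay Az.
have scaleO p q u v : complex_orthogonal u v -> complex_orthogonal (p *: u) (q *: v).
  by case=> uv uJv; split; rewrite !symE ?uv ?uJv !mulr0.
have scaleA k r u : A u = k *: u -> A (r *: u) = k *: (r *: u).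
  by rewrite linearZ /= => ->; rewrite !scalerA mulrC.
have gram r u : g (r *: u) (r *: u) = r ^+ 2 * g u u by rewrite !symE; ring.
have [r1 [s1 [_ s1s E1]]] := exists_sign_scaling xx.
have [r2 [s2 [_ s2s E2]]] := exists_sign_scaling yy.
have [r3 [s3 [_ s3s E3]]] := exists_sign_scaling zz.
(* Two of the three signs agree; they decide the overall sign. *)
have [e12|] := eqVneq s1 s2.
  apply: (@NormalDiagonal W s1 (r1 *: x) (r2 *: y) (r3 *: z) a b c) => //.
  - by rewrite !rpredZ.
  - by split; apply: scaleO.
  - rewrite !gram E1 E2 E3 -e12 (sign_sqr s1s); split=> //.
    by case: s1s s3s => -> [] ->; [left|right|right|left]; ring.
  - by split; apply: scaleA.
have [e13 _|] := eqVneq s1 s3.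
  apply: (@NormalDiagonal W s1 (r1 *: x) (r3 *: z) (r2 *: y) a c b) => //.
  - by rewrite !rpredZ.
  - by split; apply: scaleO => //; apply: complex_orthogonal_sym.
  - rewrite !gram E1 E2 E3 -e13 (sign_sqr s1s); split=> //.
    by case: s1s s2s => -> [] ->; [left|right|right|left]; ring.
  - by split; apply: scaleA.
move=> ne13 ne12; have e23 : s2 = s3.
  by case: s1s ne12 ne13 => ->; case: s2s => ->; case: s3s => ->; rewrite ?eqxx.
apply: (@NormalDiagonal W s2 (r2 *: y) (r3 *: z) (r1 *: x) b c a) => //.
- by rewrite !rpredZ.
- by split; apply: scaleO => //; apply: complex_orthogonal_sym.
- rewrite !gram E1 E2 E3 -e23 (sign_sqr s2s); split=> //.
  by case: s2s s1s => -> [] ->; [left|right|right|left]; ring.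
- by split; apply: scaleA.
Qed.

(** With N = A - a, adding real multiples of N w and N (N w) to w and scaling
    gives f with g f f = 0, g f (N f) = 0 and g f (N (N f)) a sign. Then f,
    - J N f and - N (N f) are e_5, e_3 and e_1. *)
Lemma normal_form_jordan3 (W : {vspace V}) w a : hermitian_subspace g J W ->
  (forall x, x \in W -> A x \in W) -> w \in W ->
  shift A a (shift A a (shift A a w)) = 0 ->
  g (shift A a (shift A a w)) w != 0 -> hermitian_normal_form W.
Proof.
move=> hW AW wW.
pose N := shift A a; rewrite -/(N w) -/(N (N w)) -/(N (N (N w))).
have NE x y : g (N x) y = g x (N y) by rewrite /N /shift !symE gA.
have ND x y : N (x + y) = N x + N y by rewrite /N /shift !AE; lin_eq R V.
have NZ c x : N (c *: x) = c *: N x by rewrite /N /shift !AE; lin_eq R V.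
have Nopp x : N (- x) = - N x by rewrite /N /shift !AE; lin_eq R V.
have NJ x : N (J x) = J (N x) by rewrite /N /shift !AE !symE; lin_eq R V.
have AN x : A x = a *: x + N x by rewrite /N /shift; lin_eq R V.
have NW x : x \in W -> N x \in W by move=> xW; rewrite rpredB ?rpredZ ?AW.
clearbody N => N3 c0.
have [r [s [_ sS rs]]] := exists_sign_scaling c0.
pose p := r ^+ 2 * g w (N w); pose q := r ^+ 2 * g w w.
have w3 : g (N w) (N w) = g w (N (N w)) by rewrite NE.
have ws : r ^+ 2 * g w (N (N w)) = s by rewrite symC.
(* b1 solves g f (N f) = 0, then b2 solves g f f = 0. *)
have [b1 [b2 [b1E b2E]]] : exists b1 b2, p + b1 * s *+ 2 = 0 /\
    q + b1 * p *+ 2 + (b1 ^+ 2 + b2 *+ 2) * s = 0.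
  exists (- s * p / 2).
  exists (- s * (q + (- s * p / 2) * p *+ 2) / 2 - (- s * p / 2) ^+ 2 / 2).
  by case: sS => ->; split; field.
pose f := r *: (w + b1 *: N w + b2 *: N (N w)).
have fW : f \in W by rewrite rpredZ ?rpredD ?rpredZ ?NW.
have Nf : N f = r *: (N w + b1 *: N (N w)) by rewrite /f NZ !ND !NZ N3 scaler0 addr0.
have NNf : N (N f) = r *: N (N w) by rewrite Nf NZ !ND !NZ N3 scaler0 addr0.
have NNNf : N (N (N f)) = 0 by rewrite NNf NZ N3 scaler0.
have N4 : g (N w) (N (N w)) = 0 by rewrite NE N3 sym0r.
have N5 : g (N (N w)) (N (N w)) = 0 by rewrite NE N3 sym0r.
have ff : g f f = 0.
  rewrite -[RHS]b2E /f -ws /p /q !symE (symC (N w) w) (symC (N (N w)) w) w3.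
  by rewrite (symC (N (N w)) (N w)) N4 N5; ring.
have fNf : g f (N f) = 0.
  by rewrite Nf -[RHS]b1E /f -ws /p !symE w3 (symC (N (N w))) N4 N5; ring.
have fNNf : g f (N (N f)) = s.
  by rewrite NNf -ws /f !symE N4 N5; ring.
clearbody f; clear Nf NNf.
have real1 x : g (N x) (J x) = 0.
  have := symC (N x) (J x); rewrite (symJl JJ gJJ) -NJ -NE; lra.
have real2 x : g (N (N x)) (J x) = 0 by rewrite NE NJ symJ_eq0.
apply: (@NormalJordan3 W s (- N (N f)) (- J (N f)) f a sS).
- by split; rewrite // rpredN ?(herm_J hW) ?NW.
- split=> //.
  + by rewrite !symE NE NNNf sym0r !oppr0.
  + by rewrite symNl symC fNNf mulrN sign_sqr.
  + by rewrite symNl real2 oppr0.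
- split.
  + split; first by rewrite symNl symNr real1 !oppr0.
    by rewrite JN JJ opprK symNl symC NE NNNf sym0r oppr0.
  + split; first by rewrite symNl (symJl JJ gJJ) real1 !oppr0.
    by rewrite symNl gJJ symC fNf oppr0.
  + by rewrite symNl symNr gJJ opprK NE fNNf sign_sqr.
- by split; rewrite AN ?Nopp ?NJ ?NNNf ?JN ?JJ; lin_eq R V.
Qed.

Lemma dim6_normal_form (W : {vspace V}) : hermitian_subspace g J W ->
  (forall x, x \in W -> A x \in W) -> \dim W = 6%N -> hermitian_normal_form W.
Proof.
move=> hW AW dimW.
case: (dim6_classification JJ gJJ AJ gA hW AW dimW)
  => [f a fW ff Af|w a wW]; last first.
  exact: normal_form_jordan3.
have hU := cperp_hermitian JJ gJJ hW fW ff.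
have [dimU] : 6%N = (\dim (cperp g J W f)).+2 by rewrite -(dim_cperp JJ gJJ hW fW ff).
have sub x : x \in cperp g J W f -> x \in W /\ complex_orthogonal x f.
  by case/cperpP.
case: (dim4_classification JJ gJJ AJ gA hU (cperp_stable AJ gA AW Af) (esym dimU)).
- move=> x y b c /sub[xW xf] /sub[yW yf] xx yy xy xJy Ax Ay.
  exact: (normal_form_diagonal xW yW fW _ xf yf xx yy ff Ax Ay Af).
- move=> v w b c /sub[vW vf] /sub[wW wf] [vv ww vw vJw] c0 Av Aw.
  have [r [s [r0 sS rs]]] := exists_sign_scaling ff.
  have [k [u [k0 uS ku]]] := exists_sign_scaling c0.
  (* The product of the signs of f and of the Jordan block can only be changed
     by reversing e_8. *)
  have cE : c = u / k ^+ 2 by rewrite -ku; field.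
  have orth x y p q : complex_orthogonal x y ->
      complex_orthogonal (p *: x) (q *: y) /\ complex_orthogonal (p *: J x) (q *: y).
    by case=> xy xJy; split; split; rewrite !symE ?xy ?xJy; ring.
  apply: (@NormalJordan2 W s (- s * u) ((s / k) *: J v) (k *: w) (r *: f) b a sS).
  + by case: sS uS => -> [] ->; [right|left|left|right]; ring.
  + by rewrite !rpredZ // ?(herm_J hW).
  + rewrite !symE vv ww vJw vw; split; try ring.
    by have := sign_sqr sS => ss; transitivity (s * s); [field|].
  + split; [exact: (orth _ _ _ _ vf).2|exact: (orth _ _ _ _ wf).1|].
    by rewrite !symE -(sign_sqr sS) -rs; ring.
  + have ss := sign_sqr sS; rewrite !AE Av Aw Af !symE cE; split.
    * by lin_eq R V.
    * lin_eq R V; try by field.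
      by transitivity (s * s * u / k); [rewrite ss; field|field].
    * by lin_eq R V.
- move=> v w b c /sub[vW vf] /sub[wW wf] [vv ww vw vJw] c0 Av Aw.
  have [r [s [r0 sS rs]]] := exists_sign_scaling ff.
  have ss := sign_sqr sS.
  case: vf wf => vf vJf [wf wJf].
  (* As g v w = 1, the vector - s J w satisfies s g v (J (- s J w)) = 1. *)
  apply: (@NormalComplex W s v (- s *: J w) (r *: f) c b a sS c0).
  + by rewrite !rpredZ // ?(herm_J hW).
  + by rewrite !symE vv ww vJw vw; split; ring: ss.
  + rewrite /complex_orthogonal !symE vf vJf wf wJf; split; [split; ring..|].
    by rewrite -ss -rs; ring.
  + by rewrite !AE Av Aw Af !symE; split; lin_eq R V.
Qed.

End NormalForms.

(** * Adapted bases *)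

(** If e_i pairs only with e_(sg i), the coordinates of x are, up to nonzero
    factors, its products with the e_(sg i); hence e is free, and g has a
    single term for each i in the dual basis. *)
Lemma signed_permutation_gram (R : realType) (V : vectType R) (g : {symmetric V})
    (s : R) (e : 8.-tuple V) (sg : seq nat) (c : seq R) :
  \dim {:V} = 8%N -> uniq sg -> size sg = 8%N -> all (gtn 8) sg ->
  (forall i, (i < 8)%N -> c`_i != 0) ->
  (forall i j, (i < 8)%N -> (j < 8)%N ->
     s * g e`_i e`_j = if nth 0%N sg i == j then c`_i else 0) ->
  basis_of {:V} e /\ forall x y, s * g x y =
    \sum_(0 <= i < 8) c`_i * tens (dual e i.+1) (dual e (nth 0%N sg i).+1) x y.
Proof.
move=> dim8 sg_uniq sg_size sg_lt c0 gram.
have sgP i : (i < 8)%N -> (nth 0 sg i < 8)%N.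
  by move=> i8; apply: (allP sg_lt); rewrite mem_nth ?sg_size.
have e_free : free e.
  apply/freeP => k k0 i; apply/eqP.
  have /eqP : \sum_(j < 8) k j * (s * g e`_j e`_(nth 0%N sg i)) = 0.
    transitivity (s * g (\sum_(j < 8) k j *: e`_j) e`_(nth 0%N sg i)).
      rewrite linear_sumlz mulr_sumr; apply: eq_bigr => j _.
      by rewrite linearZl_LR; ring.
    by rewrite k0 linear0l mulr0.
  rewrite (bigD1 i) //= gram ?sgP // eqxx big1 ?addr0 => [|j ji].
    by rewrite mulf_eq0 (negPf (c0 i _)) // orbF.
  by rewrite gram ?sgP // nth_uniq ?sg_size // (inj_eq val_inj) (negPf ji) mulr0.
have e_basis : basis_of {:V} e by rewrite basisEfree e_free subvf dim8 size_tuple.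
split=> // x y.
have s0 : s != 0.
  apply: contraNneq (c0 0%N isT) => s0.
  by have := gram 0%N _ isT (sgP 0%N isT); rewrite eqxx s0 mul0r => <-.
rewrite big_mkord {1}(coord_basis e_basis (memvf x)) {1}(coord_basis e_basis (memvf y)).
rewrite linear_sumlz mulr_sumr; apply: eq_bigr => i _.
rewrite linearZl_LR linear_sumr /=.
have sgi := sgP _ (ltn_ord i).
rewrite (bigD1 (Ordinal sgi)) //= big1 ?addr0 => [|j ji].
  rewrite linearZr_LR /= /tens /dual /=.
  have -> : inord i = i by apply: val_inj; rewrite /= inordK.
  have -> : inord (nth 0%N sg i) = Ordinal sgi by apply: val_inj; rewrite /= inordK.
  transitivity (coord e i x * coord e (Ordinal sgi) y * (s * g e`_i e`_(nth 0%N sg i))).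
    by ring.
  by rewrite gram // eqxx; ring.
have /eqP : s * g e`_i e`_j = 0.
  by rewrite gram //; case: eqP => // sij; case/eqP: ji; apply: val_inj.
by rewrite mulf_eq0 (negPf s0) linearZr_LR /= => /eqP->; rewrite mulr0.
Qed.

Section Conclusion.
Variables (R : realType) (V : vectType R).

Definition listed_form (e : 8.-tuple V) (D : 'M[R]_7) (gamma : V -> V -> R) : Prop :=
  (exists l1 l2 l3 a : R,
     D = D_diagonal l1 l2 l3 a /\ gamma =2 gamma_definite e) \/
  (exists l1 l2 a : R,
     D = D_nilpotent2 l1 l2 a /\ gamma =2 gamma_odot e) \/
  (exists l1 l2 l3 a : R,
     D = D_diagonal l1 l2 l3 a /\ gamma =2 gamma_diagonal e) \/
  (exists rho1 l1 l2 a : R,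
     [/\ 0 < rho1, D = D_hyperbolic rho1 l1 l2 a & gamma =2 gamma_odot e]) \/
  (exists l a : R,
     D = D_nilpotent3 l a /\ gamma =2 gamma_nilpotent3 e).

Definition has_normal_form (br : V -> V -> V) (h : {vspace V}) (J : V -> V)
    (g : V -> V -> R) : Prop :=
  exists (s eps : R) (e : 8.-tuple V) (D : 'M[R]_7) (gamma : V -> V -> R),
    (s = 1 \/ s = -1) /\ (eps = 1 \/ eps = -1) /\
    basis_of {:V} e /\
    h = <<take 7 e>>%VS /\
    [/\ J (bvec e 1) = bvec e 2, J (bvec e 3) = bvec e 4,
        J (bvec e 5) = bvec e 6 & J (bvec e 7) = bvec e 8] /\
    (forall x y : V, s * g x y = gamma x y +
       eps * (tens (dual e 7) (dual e 7) x y + tens (dual e 8) (dual e 8) x y)) /\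
    ad8_matrix br e D /\ listed_form e D gamma.

End Conclusion.

Lemma sign_neq0 (R : realType) (s : R) : is_sign s -> s != 0.
Proof. by case=> ->; rewrite ?oppr_eq0 oner_neq0. Qed.

(** Here n is a unit vector orthogonal to h, and e_8 = t n, which forces
    e_7 = - t J n. *)
Section Assembly.
Variables (R : realType) (V : vectType R).
Variables (br : {bilinear V -> V -> V}) (h : {vspace V}) (g : {symmetric V}).
Variables (J A : {linear V -> V}) (W : {vspace V}) (n : V) (eps0 a : R).
Hypothesis dim8 : \dim {:V} = 8%N.
Hypothesis JJ : forall x, J (J x) = - x.
Hypothesis gJJ : forall x y, g (J x) (J y) = g x y.
Hypothesis AJ : forall x, A (J x) = J (A x).
Hypothesis eps0_sign : is_sign eps0.
Hypothesis gnn : g n n = eps0.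
Hypothesis Wn : forall x, x \in W -> complex_orthogonal g J x n.
Hypothesis JW : forall x, x \in W -> J x \in W.
Hypothesis Wh : (W <= h)%VS.
Hypothesis Jnh : J n \in h.
Hypothesis dimh : \dim h = 7%N.
Hypothesis brW : forall x, x \in W -> br n x = - J (A x).
Hypothesis brJn : br n (J n) = a *: J n.

Let symE := symE JJ gJJ.

Definition frame t (f1 f2 f3 : V) : 8.-tuple V :=
  [tuple f1; J f1; f2; J f2; f3; J f3; - t *: J n; t *: n].

Lemma frame_span t f1 f2 f3 : f1 \in W -> f2 \in W -> f3 \in W ->
  free (frame t f1 f2 f3) -> h = <<take 7 (frame t f1 f2 f3)>>%VS.
Proof.
move=> f1W f2W f3W e_free; apply/esym/eqP; rewrite eqEdim; apply/andP; split.
  apply/span_subvP => x; rewrite /= !inE.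
  have WJh y : y \in W -> (y \in h) /\ (J y \in h).
    by move=> yW; rewrite !(subvP Wh) ?JW.
  have [? ?] := WJh _ f1W; have [? ?] := WJh _ f2W; have [? ?] := WJh _ f3W.
  by do 6?[case/predU1P=> [->//|]]; move/eqP->; rewrite rpredZ.
have : free (take 7 (frame t f1 f2 f3)).
  by move: e_free; rewrite -{1}[tval _](cat_take_drop 7) => /catl_free.
by rewrite /free => /eqP->; rewrite dimh.
Qed.

Lemma frame_J t f1 f2 f3 (e := frame t f1 f2 f3) :
  [/\ J (bvec e 1) = bvec e 2, J (bvec e 3) = bvec e 4,
      J (bvec e 5) = bvec e 6 & J (bvec e 7) = bvec e 8].
Proof.
by split=> //; rewrite /bvec /= !symE; lin_eq R V.
Qed.

Lemma br_frame_J t x : x \in W -> br (t *: n) (J x) = t *: A x.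
Proof. by move=> xW; rewrite linearZl_LR /= brW ?JW // AJ !symE opprK. Qed.

Lemma br_frame t x : x \in W -> br (t *: n) x = - t *: J (A x).
Proof. by move=> xW; rewrite linearZl_LR /= brW // scalerN scaleNr. Qed.

Lemma br_frame_7 t : br (t *: n) (- t *: J n) = (t * a) *: (- t *: J n).
Proof. by rewrite linearZl_LR linearZr_LR /= brJn; lin_eq R V. Qed.


(* Runs through the seven columns of the matrix of ad e_8. *)
Ltac check_columns A1 A2 A3 :=
  move=> [[|[|[|[|[|[|[|//]]]]]]] ?];
  rewrite !big_ord_recr big_ord0 !mxE /bvec /=
    ?br_frame_7 ?br_frame_J ?br_frame // ?A1 ?A2 ?A3 ?symE;
  lin_eq R V.

Lemma ad_diagonal t f1 f2 f3 l1 l2 l3 :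
  [/\ f1 \in W, f2 \in W & f3 \in W] ->
  [/\ A f1 = l1 *: f1, A f2 = l2 *: f2 & A f3 = l3 *: f3] ->
  ad8_matrix br (frame t f1 f2 f3) (D_diagonal (t * l1) (t * l2) (t * l3) (t * a)).
Proof. by move=> [f1W f2W f3W] [A1 A2 A3]; check_columns A1 A2 A3. Qed.

Lemma ad_jordan2 t f1 f2 f3 l1 l2 : is_sign t ->
  [/\ f1 \in W, f2 \in W & f3 \in W] ->
  [/\ A f1 = l1 *: f1, A f2 = l1 *: f2 + t *: J f1 & A f3 = l2 *: f3] ->
  ad8_matrix br (frame t f1 f2 f3) (D_nilpotent2 (t * l1) (t * l2) (t * a)).
Proof.
move=> tS [f1W f2W f3W] [A1 A2 A3].
by check_columns A1 A2 A3; case: tS => ->; ring.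
Qed.

Lemma ad_complex f1 f2 f3 rho l1 l2 :
  [/\ f1 \in W, f2 \in W & f3 \in W] ->
  [/\ A f1 = l1 *: f1 + rho *: J f1, A f2 = l1 *: f2 - rho *: J f2
    & A f3 = l2 *: f3] ->
  ad8_matrix br (frame 1 f1 f2 f3) (D_hyperbolic rho l1 l2 a).
Proof. by move=> [f1W f2W f3W] [A1 A2 A3]; check_columns A1 A2 A3. Qed.

Lemma ad_jordan3 f1 f2 f3 l : [/\ f1 \in W, f2 \in W & f3 \in W] ->
  [/\ A f1 = l *: f1, A f2 = l *: f2 + J f1 & A f3 = l *: f3 + J f2] ->
  ad8_matrix br (frame 1 f1 f2 f3) (D_nilpotent3 l a).
Proof. by move=> [f1W f2W f3W] [A1 A2 A3]; check_columns A1 A2 A3. Qed.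

Lemma sign_mul_eq (s x y : R) : is_sign s -> s * x = y -> x = s * y.
Proof. by move=> /sign_sqr ss <-; rewrite mulrA ss mul1r. Qed.

Lemma orthogonalE x y : complex_orthogonal g J x y ->
  (g x y = 0) * (g x (J y) = 0) * (g y x = 0) * (g y (J x) = 0).
Proof. by move=> xy; have [? ?] := complex_orthogonal_sym JJ gJJ xy; case: xy. Qed.

(* Runs through the 64 products of basis vectors, each of which reduces to one
   of the given rewrite rules. *)
Ltac check_gram sS tS o12 o13 o23 nE :=
  move=> [|[|[|[|[|[|[|[|//]]]]]]]] [|[|[|[|[|[|[|[|//]]]]]]]] _ _ /=;
  rewrite ?symE ?o12 ?o13 ?o23 ?nE ?gnn; try ring;
  case: sS => ->; try ring; case: tS => ->; ring.

Lemma gram_diagonal s t f1 f2 f3 c (e := frame t f1 f2 f3) :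
  is_sign s -> is_sign t ->
  [/\ f1 \in W, f2 \in W & f3 \in W] ->
  [/\ complex_orthogonal g J f1 f2, complex_orthogonal g J f1 f3
    & complex_orthogonal g J f2 f3] ->
  [/\ s * g f1 f1 = 1, s * g f2 f2 = 1 & s * g f3 f3 = c] ->
  is_sign c ->
  basis_of {:V} e /\ forall x y, s * g x y =
    \sum_(0 <= i < 8) [:: 1; 1; 1; 1; c; c; s * eps0; s * eps0]`_i *
        tens (dual e i.+1) (dual e (nth 0%N (iota 0 8) i).+1) x y.
Proof.
move=> sS tS [f1W f2W f3W] [o12 o13 o23] [n1 n2 n3] cS.
apply: signed_permutation_gram => //.
  have c0 := sign_neq0 cS; have e0 : s * eps0 != 0 by rewrite mulf_neq0 ?sign_neq0.
  by move=> [|[|[|[|[|[|[|[|//]]]]]]]] _; rewrite /= ?oner_neq0.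
have oE := (orthogonalE (Wn f1W), orthogonalE (Wn f2W), orthogonalE (Wn f3W)).
have nE := (sign_mul_eq sS n1, sign_mul_eq sS n2, sign_mul_eq sS n3, oE).
check_gram sS tS (orthogonalE o12) (orthogonalE o13) (orthogonalE o23) nE.
Qed.

Lemma gram_odot s t f1 f2 f3 (e := frame t f1 f2 f3) :
  is_sign s -> is_sign t ->
  [/\ f1 \in W, f2 \in W & f3 \in W] ->
  [/\ g f1 f1 = 0, g f2 f2 = 0, g f1 f2 = 0 & s * g f1 (J f2) = 1] ->
  [/\ complex_orthogonal g J f1 f3, complex_orthogonal g J f2 f3
    & s * g f3 f3 = 1] ->
  basis_of {:V} e /\ forall x y, s * g x y =
    \sum_(0 <= i < 8) [:: 1; -1; -1; 1; 1; 1; s * eps0; s * eps0]`_i *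
      tens (dual e i.+1)
        (dual e (nth 0%N [:: 3; 2; 1; 0; 4; 5; 6; 7]%N i).+1) x y.
Proof.
move=> sS tS [f1W f2W f3W] [n11 n22 n12 n1J2] [o13 o23 n3].
apply: signed_permutation_gram => //.
  have e0 : s * eps0 != 0 by rewrite mulf_neq0 ?sign_neq0.
  by move=> [|[|[|[|[|[|[|[|//]]]]]]]] _; rewrite /= ?oppr_eq0 ?oner_neq0.
have oE := (orthogonalE (Wn f1W), orthogonalE (Wn f2W), orthogonalE (Wn f3W)).
have n2J1 : g f2 (J f1) = - g f1 (J f2) by rewrite symC (symJl JJ gJJ).
have n21 : g f2 f1 = 0 by rewrite symC.
have n12E := (n2J1, n11, n22, n12, n21, sign_mul_eq sS n1J2).
check_gram sS tS n12E (orthogonalE o13) (orthogonalE o23) (sign_mul_eq sS n3, oE).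
Qed.

Lemma gram_jordan3 s t f1 f2 f3 (e := frame t f1 f2 f3) :
  is_sign s -> is_sign t ->
  [/\ f1 \in W, f2 \in W & f3 \in W] ->
  [/\ g f1 f1 = 0, g f3 f3 = 0, s * g f1 f3 = -1 & g f1 (J f3) = 0] ->
  [/\ complex_orthogonal g J f1 f2, complex_orthogonal g J f2 f3
    & s * g f2 f2 = 1] ->
  basis_of {:V} e /\ forall x y, s * g x y =
    \sum_(0 <= i < 8) [:: -1; -1; 1; 1; -1; -1; s * eps0; s * eps0]`_i *
      tens (dual e i.+1)
        (dual e (nth 0%N [:: 4; 5; 2; 3; 0; 1; 6; 7]%N i).+1) x y.
Proof.
move=> sS tS [f1W f2W f3W] [n11 n33 n13 n1J3] [o12 o23 n2].
apply: signed_permutation_gram => //.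
  have e0 : s * eps0 != 0 by rewrite mulf_neq0 ?sign_neq0.
  by move=> [|[|[|[|[|[|[|[|//]]]]]]]] _; rewrite /= ?oppr_eq0 ?oner_neq0.
have oE := (orthogonalE (Wn f1W), orthogonalE (Wn f2W), orthogonalE (Wn f3W)).
have n3J1 : g f3 (J f1) = 0 by rewrite symC (symJl JJ gJJ) n1J3 oppr0.
have n31 : g f3 f1 = g f1 f3 by rewrite symC.
have n13E := (n3J1, n11, n33, n31, n1J3, sign_mul_eq sS n13).
check_gram sS tS n13E (orthogonalE o12) (orthogonalE o23) (sign_mul_eq sS n2, oE).
Qed.

Lemma frame_normal_form s t f1 f2 f3 D gamma (e := frame t f1 f2 f3) :
  is_sign s -> is_sign t -> [/\ f1 \in W, f2 \in W & f3 \in W] ->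
  basis_of {:V} e ->
  (forall x y, s * g x y = gamma x y + s * eps0 *
     (tens (dual e 7) (dual e 7) x y + tens (dual e 8) (dual e 8) x y)) ->
  ad8_matrix br e D -> listed_form e D gamma -> has_normal_form br h J g.
Proof.
move=> sS tS [f1W f2W f3W] e_basis gE ad_e Pe.
exists s, (s * eps0), e, D, gamma; do 4?[split=> //].
- by case: sS eps0_sign => -> [] ->; [left|right|right|left]; ring.
- exact: frame_span (basis_free e_basis).
- by split; first exact: frame_J.
Qed.

Lemma adapted_normal_form :
  hermitian_normal_form g J A W -> has_normal_form br h J g.
Proof.
have one : is_sign (1 : R) by left.
case=> [s f1 f2 f3 l1 l2 l3 sS fW orth [n1 n2 cS] AE
       |s t f1 f2 f3 l1 l2 sS tS fW hyp orth AE
       |s f1 f2 f3 rho l1 l2 sS rho_gt0 fW hyp orth AE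
       |s f1 f2 f3 l sS fW hyp orth AE].
- have [e_basis gE] := gram_diagonal sS one fW orth (And3 n1 n2 (erefl _)) cS.
  have ad_e := ad_diagonal 1 fW AE.
  case: cS => cE; rewrite cE in gE.
    apply: (frame_normal_form (gamma := gamma_definite (frame 1 f1 f2 f3))
      sS one fW e_basis _ ad_e).
      by move=> x y; rewrite gE /gamma_definite unlock /=; ring.
    by left; do 4!eexists; split; [reflexivity|].
  apply: (frame_normal_form (gamma := gamma_diagonal (frame 1 f1 f2 f3))
    sS one fW e_basis _ ad_e).
    by move=> x y; rewrite gE /gamma_diagonal unlock /=; ring.
  by right; right; left; do 4!eexists; split; [reflexivity|].
- have [e_basis gE] := gram_odot sS tS fW hyp orth.
  apply: (frame_normal_form (gamma := gamma_odot (frame t f1 f2 f3))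
    sS tS fW e_basis _ (ad_jordan2 tS fW AE)).
    by move=> x y; rewrite gE /gamma_odot /odot unlock /=; ring.
  by right; left; do 3!eexists; split; [reflexivity|].
- have [e_basis gE] := gram_odot sS one fW hyp orth.
  apply: (frame_normal_form (gamma := gamma_odot (frame 1 f1 f2 f3))
    sS one fW e_basis _ (ad_complex fW AE)).
    by move=> x y; rewrite gE /gamma_odot /odot unlock /=; ring.
  by do 3!right; left; do 4!eexists; split; [exact: rho_gt0|reflexivity|].
- have [e_basis gE] := gram_jordan3 sS one fW hyp orth.
  apply: (frame_normal_form (gamma := gamma_nilpotent3 (frame 1 f1 f2 f3))
    sS one fW e_basis _ (ad_jordan3 fW AE)).
    by move=> x y; rewrite gE /gamma_nilpotent3 /odot unlock /=; ring.
  by do 4!right; do 2!eexists; split; [reflexivity|].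
Qed.

End Assembly.

(** * From the Lie algebra to the Hermitian operator *)
Section Reduction.
Variables (R : realType) (V : vectType R).
Variables (br : {bilinear V -> V -> V}) (h : {vspace V}).
Variables (J : {linear V -> V}) (g : {symmetric V}) (n : V).
Hypothesis brxx : forall x, br x x = 0.
Hypothesis dim8 : \dim {:V} = 8%N.
Hypothesis ideal_h : codim1_abelian_ideal br h.
Hypothesis JJ : forall x, J (J x) = - x.
Hypothesis gJJ : forall x y, g (J x) (J y) = g x y.
Hypothesis integrable : forall x y,
  br x y + J (br (J x) y) + J (br x (J y)) - br (J x) (J y) = 0.
Hypothesis gnd : nondegenerate g.
Hypothesis closed : closed_2form br (fun x y => g (J x) y).
Hypothesis n_perp : n \in orthov g h.
Hypothesis gnn : g n n != 0.

Let symE := symE JJ gJJ.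
Let symC := symC g.

Lemma brC x y : br x y = - br y x.
Proof.
apply/eqP; rewrite -addr_eq0; have := brxx (x + y).
by rewrite linearDl !linearDr !brxx add0r addr0 => ->.
Qed.

Lemma hermitian_fullv : hermitian_subspace g J fullv.
Proof.
split=> x _; first exact: memvf.
move=> x0; apply/eqP; rewrite -memv0 -(eqP gnd); apply/mem_orthovP => y yV.
exact: x0.
Qed.

Lemma dim_ideal : \dim h = 7%N.
Proof. by have := ideal_codim1 ideal_h; rewrite dim8 => -[]. Qed.

(** h is contained in the orthogonal of n, and both have dimension 7. *)
Lemma mem_ideal x : (x \in h) = (g x n == 0).
Proof.
suff -> : h = orthov g <[n]> by rewrite mem_orthov1.
apply/eqP; rewrite eqEdim; apply/andP; split.
  apply/subvP => y yh; rewrite mem_orthov1 symC.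
  by move/mem_orthovP: n_perp => ->.
have n_notin : n \notin orthov g fullv.
  by apply/mem_orthovPn; exists n; rewrite ?memvf.
by have := eq_dim_orthov1 n_notin; rewrite capfv dim8 dim_ideal => <-.
Qed.

Let W := cperp g J fullv n.

Lemma perp_in_ideal x : x \in W -> [/\ x \in h, J x \in h & J x \in W].
Proof.
have hW := cperp_hermitian JJ gJJ hermitian_fullv (memvf n) gnn.
move=> xW; have JxW := herm_J hW xW.
have memh y : y \in W -> y \in h by case/cperpP => _ /eqP; rewrite mem_ideal.
by split; rewrite ?memh.
Qed.

Lemma Jn_ideal : J n \in h.
Proof. by rewrite mem_ideal symC symJ_eq0. Qed.

(** In the integrability condition for x and n, the two brackets with J n
    vanish since h is abelian. *)
Lemma ad_J x : x \in W -> br n (J x) = J (br n x).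
Proof.
move=> xW; have [xh Jxh _] := perp_in_ideal xW.
have := integrable x n.
rewrite (ideal_abelian ideal_h xh Jn_ideal) (ideal_abelian ideal_h Jxh Jn_ideal).
rewrite linear0 addr0 subr0 (brC x n) (brC (J x) n) => /(congr1 J).
by rewrite !symE opprK linear0 addrC => /subr0_eq.
Qed.

Lemma ad_stable x : x \in W -> br n x \in W.
Proof.
move=> xW; have [xh Jxh _] := perp_in_ideal xW.
have brh y : y \in h -> g (br n y) n = 0.
  by move=> yh; apply/eqP; rewrite -mem_ideal; apply: (ideal_closed ideal_h).
apply/cperpP; split; rewrite ?memvf ?brh //.
by apply/eqP; rewrite -oppr_eq0 -(symJl JJ gJJ) -ad_J // brh.
Qed.

(** The closedness condition for x, y and n, where the bracket of x and y
    vanishes. *)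
Lemma closed_h x y : x \in h -> y \in h ->
  g (J (br n x)) y = g (J (br n y)) x.
Proof.
move=> xh yh; have := closed x y n.
rewrite (ideal_abelian ideal_h xh yh) linear0 sym0l add0r (brC y n) JN symNl.
by move/eqP; rewrite addrC subr_eq0 => /eqP.
Qed.

Lemma ad_skew x y : x \in W -> y \in W -> g (br n x) y = - g x (br n y).
Proof.
move=> xW yW; have [xh _ _] := perp_in_ideal xW; have [_ Jyh JyW] := perp_in_ideal yW.
have := closed_h xh Jyh.
by rewrite gJJ -ad_J // JJ linearNr symNl => ->; rewrite symC.
Qed.

(** By closedness, the bracket of n and J n is orthogonal to W; as an element of
    h it is also orthogonal to n. *)
Lemma ad_Jn : exists a, br n (J n) = a *: J n.
Proof.
have hW := cperp_hermitian JJ gJJ hermitian_fullv (memvf n) gnn.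
have /eqP un : g (br n (J n)) n == 0.
  by rewrite -mem_ideal; apply: (ideal_closed ideal_h); exact: Jn_ideal.
have uW y : y \in W -> g (br n (J n)) y = 0.
  move=> yW; have [_ Jyh _] := perp_in_ideal yW.
  have [_ _ JyW] := perp_in_ideal yW.
  have := closed_h Jn_ideal Jyh; rewrite gJJ => ->.
  by rewrite gJJ; case/cperpP: (ad_stable JyW).
exists (g (br n (J n)) (J n) / g n n); apply/eqP; rewrite -subr_eq0; apply/eqP.
have decomp := cperp_decomp JJ gJJ hermitian_fullv (memvf n) gnn (memvf (br n (J n))).
rewrite un mul0r scale0r subr0 in decomp.
apply: (herm_nondeg hW decomp) => y yW; have [_ _ JyW] := perp_in_ideal yW.
have [_ yn yJn] := cperpP _ _ _ _ _ yW.
by rewrite symDl symNl symZl uW // (symC (J n) y) yJn; ring.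
Qed.

(* The orthogonal projection onto W. Composing with it gives an operator which
   is self-adjoint and commutes with J on all of V, not only on W. *)
Let pr x := x - (g x n / g n n) *: n - (g x (J n) / g n n) *: J n.

Lemma prW x : pr x \in W.
Proof. exact: (cperp_decomp JJ gJJ hermitian_fullv (memvf n) gnn (memvf x)). Qed.

Lemma pr_id x : x \in W -> pr x = x.
Proof. by case/cperpP=> _ xn xJn; rewrite /pr xn xJn !mul0r !scale0r !subr0. Qed.

Lemma pr_sym x y : x \in W -> g x (pr y) = g x y.
Proof. by case/cperpP=> _ xn xJn; rewrite /pr !(symDr, symNr, symZr) xn xJn; ring. Qed.

Lemma prJ x : pr (J x) = J (pr x).
Proof. by rewrite /pr !symE; lin_eq R V; field. Qed.

Lemma exists_hermitian_operator : exists A : {linear V -> V},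
  [/\ forall x, A (J x) = J (A x), forall x y, g (A x) y = g x (A y),
      forall x, A x \in W & forall x, x \in W -> br n x = - J (A x)].
Proof.
pose A0 x := J (br n (pr x)).
have A0_linear : linear A0.
  move=> c x y; rewrite /A0 -[RHS]linearP -linearPr; congr (J (br n _)).
  by rewrite /pr !symE; lin_eq R V; field.
pose A : {linear V -> V} := HB.pack A0 (GRing.isLinear.Build R V V _ A0 A0_linear).
have AW x : A x \in W by have [] := perp_in_ideal (ad_stable (prW x)).
exists A; split=> //.
- by move=> x; rewrite /A /= /A0 prJ ad_J // prW.
- have gAE x y : g (A x) y = - g (br n (pr x)) (J (pr y)).
    by rewrite -(pr_sym y (AW x)) /A /= /A0 (symJl JJ gJJ).
  move=> x y; rewrite [RHS]symC !gAE ad_skew ?prW -?prJ ?prW // prJ ad_J ?prW //.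
  by rewrite opprK prJ [in RHS]symC (symJl JJ gJJ) opprK.
- by move=> x xW; rewrite /A /= /A0 pr_id // JJ opprK.
Qed.

Lemma pseudo_kahler_normal_form : is_sign (g n n) -> has_normal_form br h J g.
Proof.
move=> gnn_sign; have full := hermitian_fullv.
have hW := cperp_hermitian JJ gJJ full (memvf n) gnn.
have dimW : \dim W = 6%N.
  by have := dim_cperp JJ gJJ full (memvf n) gnn; rewrite dim8 => -[].
have [A [AJ gA AW brA]] := exists_hermitian_operator.
have [a brJn] := ad_Jn.
have Wn x : x \in W -> complex_orthogonal g J x n by case/cperpP.
have Wh : (W <= h)%VS by apply/subvP => x /perp_in_ideal[].
exact: (adapted_normal_form dim8 JJ gJJ AJ gnn_sign (erefl _) Wn (herm_J hW) Wh
  Jn_ideal dim_ideal brA brJn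
  (dim6_normal_form JJ gJJ AJ gA hW (fun x _ => AW x) dimW)).
Qed.

End Reduction.

Theorem proposition3p11 (R : realType) (V : vectType R)
    (br : {bilinear V -> V -> V}) (h : {vspace V})
    (J : 'End(V)) (g : {symmetric V})
    (lie_br : is_lie_bracket br)
    (dim8 : \dim {:V} = 8%N)
    (ideal_h : codim1_abelian_ideal br h)
    (kahler : is_pseudo_kahler br J g)
    (hperp : non_isotropic g (orthov g h)) :
  exists (s eps : R) (e : 8.-tuple V) (D : 'M[R]_7) (gamma : V -> V -> R),
    (s = 1 \/ s = -1) /\ (eps = 1 \/ eps = -1) /\
    basis_of {:V} e /\
    h = <<take 7 e>>%VS /\
    [/\ J (bvec e 1) = bvec e 2, J (bvec e 3) = bvec e 4,
        J (bvec e 5) = bvec e 6 & J (bvec e 7) = bvec e 8] /\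
    (forall x y : V, s * g x y = gamma x y +
       eps * (tens (dual e 7) (dual e 7) x y + tens (dual e 8) (dual e 8) x y)) /\
    ad8_matrix br e D /\
    ((exists l1 l2 l3 a : R,
        D = D_diagonal l1 l2 l3 a /\ gamma =2 gamma_definite e) \/
     (exists l1 l2 a : R,
        D = D_nilpotent2 l1 l2 a /\ gamma =2 gamma_odot e) \/
     (exists l1 l2 l3 a : R,
        D = D_diagonal l1 l2 l3 a /\ gamma =2 gamma_diagonal e) \/
     (exists rho1 l1 l2 a : R,
        [/\ 0 < rho1, D = D_hyperbolic rho1 l1 l2 a & gamma =2 gamma_odot e]) \/
     (exists l a : R,
        D = D_nilpotent3 l a /\ gamma =2 gamma_nilpotent3 e)).
Proof.
have [brxx _] := lie_br.
have [[JJ integrable] gnd gJJ closed] := kahler.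
have [x0 x0_perp x0x0] := hperp.
have [r [eps0 [r0 eps0S rE]]] := exists_sign_scaling x0x0.
have gnn : g (r *: x0) (r *: x0) = eps0 by rewrite -rE symZl symZr; ring.
apply: (@pseudo_kahler_normal_form R V br h J g (r *: x0)) => //.
- by rewrite rpredZ.
- by rewrite gnn sign_neq0.
- by rewrite gnn.
Qed.
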